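(* $$A_2(12,4;4)\ge 19\,676\,797.$$
   Context: For a prime power $q$, the subspace distance between subspaces $U,U'$ of $\mathbb{F}_q^n$ is $d(U,U')=\dim(U+U')-\dim(U\cap U')$. $A_q(n,d;k)$ denotes the maximum cardinality of a set of $k$-dimensional subspaces of $\mathbb{F}_q^n$ any two distinct elements of which have subspace distance at least $d$ (a set with at most one element satisfies this vacuously). Here $q=2$. *)

(* Defs.v *)
From HB Require Import structures.
From mathcomp Require Import all_boot all_order all_algebra.

Set Implicit Arguments.
Unset Strict Implicit.
Unset Printing Implicit Defensive.

(* Over a finite field there are finitely many subspaces, so that sets of
   subspaces have type {set {vspace _}}. *)
Section FiniteVspace.
Import VectorInternalTheory.
Variables (F : finFieldType) (vT : vectType F).
HB.instance Definition _ := [Countable of {vspace vT} by <:].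
HB.instance Definition _ := [Finite of {vspace vT} by <:].
End FiniteVspace.

(* The truncated subtraction is exact, since U :&: V is contained in U + V. *)
Definition subspace_dist (F : fieldType) (vT : vectType F)
    (U V : {vspace vT}) : nat :=
  \dim (U + V)%VS - \dim (U :&: V)%VS.

Definition is_subspace_code (F : finFieldType) (n d k : nat)
    (C : {set {vspace 'rV[F]_n}}) : bool :=
  [forall U in C, \dim U == k] &&
  [forall U in C, forall V in C, (U != V) ==> (d <= subspace_dist U V)].

(* A_q(n, d; k), where F stands for the field of order q, which q determines
   up to isomorphism. *)
Definition max_code_size (F : finFieldType) (n d k : nat) : nat :=
  \max_(C : {set {vspace 'rV[F]_n}} | is_subspace_code d k C) #|C|.

(* Main.v *)
From Stdlib Require Import PeanoNat.
Require Import Defs.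
From mathcomp Require Import all_boot all_order all_algebra.
From mathcomp Require Import all_field zify.

Set Implicit Arguments.
Unset Strict Implicit.
Unset Printing Implicit Defensive.

Import GRing.Theory.
Local Open Scope ring_scope.

(** Write F_2^12 = X + Y + Z with X, Y and Z copies of F_2^4. Two solids, that
is 4-dimensional subspaces, are at distance at least 4 if and only if they meet
in dimension at most 2, so it suffices to exhibit enough solids of F_2^12 with
this property ([leq_max_code_size]).

Everything is built from one operation: for subspaces K of A and L of B and a
linear map f from K to B, the extension of K by L along f is the subspace of
A + B spanned by L and the graph of f ([ext_mx]). Two estimates control the
intersections. The intersection of two extensions has dimension at most
dim (K :&: K') + dim (L :&: L') ([rank_cap_ext]). For the same K and for L'
contained in L, if f' - f is delta modulo L, for a map delta from K to a
complement of L, then the dimension is at most dim K - rank delta + dim L'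
([rank_cap_ext_same]). The maps come from sets D4 of at least 2^12
matrices of order 4 and D3 of at least 2^6 matrices of order 3 in which any two
matrices differ by a matrix of rank at least 2 ([mrd_code]), and the lines of
F_2^4 from a partition of the 35 lines into 7 spreads of 5 lines
([parallelism]). The counts below take 2^12 and 2^6 for the sizes of D4 and D3,
which gives a lower bound.

In X + Y there are 4096 + 700 solids that meet pairwise in dimension at most 2
([solid_cap]): the graphs of the maps in D4, and, for each pair of lines G of X
and H of Y taken from the same spread, 4 extensions of G by H. Each of these
4796 solids has 4096 extensions by 0, given by D4. This gives 4796 * 4096 words
that meet Z trivially.

The other words meet Z in a point. For a point p, a line G of the first spread
and one of 8 suitable maps psi, let U be the extension of G by p along psi, a
plane of X + Y. The planes U with the same p meet pairwise in at most a point,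
and distinct planes with different p meet in at most a line ([plane_cap]). No U
lies in a solid above: this could only happen if the solid came from G and the
line H of the first spread through p, and modulo H the maps psi avoid the 4 maps
used for that solid ([plane_solid_cap]). Each of the 15 * 5 * 8 = 600 planes has
64 extensions by the copy of p in Z, given by D3. Altogether there are
4796 * 4096 + 600 * 64 = 19682816 words. *)

(** * Codes from matrices with small common row space *)

Section RowVspace.
Variables (F : fieldType) (n : nat).

(** The row space of a matrix, as a subspace of the space of row vectors. *)
Definition row_vspace m (A : 'M[F]_(m, n)) : {vspace 'rV[F]_n} :=
  limg (linfun (mulmxr A)).

Lemma mem_row_vspace m (A : 'M[F]_(m, n)) v :
  (v \in row_vspace A) = (v <= A)%MS.
Proof.
apply/memv_imgP/submxP => [[u _ ->] | [u ->]].
  by exists u; rewrite lfunE.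
by exists u; rewrite ?memvf // lfunE.
Qed.

Lemma dim_row_vspace m (A : 'M[F]_(m, n)) : \dim (row_vspace A) = \rank A.
Proof.
(* A row base of A has independent rows, so right multiplication by it is
   injective. *)
have -> : row_vspace A = row_vspace (row_base A).
  by apply/vspaceP => v; rewrite !mem_row_vspace eq_row_base.
rewrite limg_dim_eq; first by rewrite dimvf /= /dim /= mul1n.
apply/eqP; rewrite -subv0; apply/subvP => v /memv_capP [_].
rewrite memv_ker lfunE /= => /eqP vA0; rewrite memv0.
by apply/eqP/(row_free_inj (row_base_free A)); rewrite mul0mx.
Qed.

Lemma row_vspace_cap m1 m2 (A : 'M[F]_(m1, n)) (B : 'M[F]_(m2, n)) :
  (row_vspace A :&: row_vspace B)%VS = row_vspace (A :&: B)%MS.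
Proof.
by apply/vspaceP => v; rewrite memv_cap !mem_row_vspace sub_capmx.
Qed.

End RowVspace.

(** Matrices of full row rank whose row spaces meet pairwise in codimension at
least e span distinct subspaces, which form a code of minimum distance
at least 2 e. *)
Lemma leq_max_code_size (F : finFieldType) (n k e : nat) (I : finType)
    (N : I -> 'M[F]_(k, n)) :
    (0 < e <= k)%N -> (forall i, row_free (N i)) ->
    (forall i j, i != j -> (\rank (N i :&: N j)%MS <= k - e)%N) ->
  (#|I| <= max_code_size F n e.*2 k)%N.
Proof.
case/andP=> e_gt0 le_e_k freeN capN.
have dimN i : \dim (row_vspace (N i)) = k.
  by rewrite dim_row_vspace (eqP (freeN i)).
have injN : injective (fun i => row_vspace (N i)).
  move=> i j eqN; apply/eqP; apply/negPn/negP => /capN.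
  rewrite -dim_row_vspace -row_vspace_cap eqN capvv dimN leqNgt ltn_subrL e_gt0.
  by rewrite (leq_trans e_gt0).
rewrite -(card_imset _ injN); apply: leq_bigmax_cond.
apply/andP; split.
  by apply/forall_inP => _ /imsetP [i _ ->]; rewrite dimN.
apply/forall_inP => _ /imsetP [i _ ->]; apply/forall_inP => _ /imsetP [j _ ->].
apply/implyP => neq_ij; have {}neq_ij: i != j by apply: contraNneq neq_ij => ->.
have := capN i j neq_ij; rewrite -dim_row_vspace -row_vspace_cap.
have := dimv_sum_cap (row_vspace (N i)) (row_vspace (N j)).
rewrite /subspace_dist !dimN.
move: (\dim _) (\dim _) => dsum dcap; rewrite -addnn; lia.
Qed.

Section Ranks.
Variable F : fieldType.

Lemma rank_capl m1 m2 n (A : 'M[F]_(m1, n)) (B : 'M_(m2, n)) :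
  (\rank (A :&: B)%MS <= m1)%N.
Proof. exact: leq_trans (mxrankS (capmxSl _ _)) (rank_leq_row _). Qed.

Lemma rank_capr m1 m2 n (A : 'M[F]_(m1, n)) (B : 'M_(m2, n)) :
  (\rank (A :&: B)%MS <= m2)%N.
Proof. exact: leq_trans (mxrankS (capmxSr _ _)) (rank_leq_row _). Qed.

Lemma row_free0 n : row_free (0 : 'M[F]_(0, n)).
Proof. by rewrite /row_free mxrank0. Qed.

Lemma row_free1 n : row_free (1%:M : 'M[F]_n).
Proof. by rewrite /row_free mxrank1. Qed.

Lemma row_free_col_mx m1 m2 n (A : 'M[F]_(m1, n)) (B : 'M_(m2, n)) :
  row_free A -> row_free B -> (A :&: B)%MS = 0 -> row_free (col_mx A B).
Proof.
move=> /eqP rA /eqP rB AB0; rewrite /row_free -addsmxE.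
by rewrite mxrank_disjoint_sum // rA rB.
Qed.

Lemma rank_le1_mul m n (A : 'M[F]_(m, n)) :
  (\rank A <= 1)%N -> exists (u : 'cV_m) (v : 'rV_n), A = u *m v.
Proof.
rewrite -[A in exists u v, A = _]mulmx_base.
move: (\rank A) (col_base A) (row_base A) => [|[|//]] u v _.
  by exists 0, 0; rewrite mul0mx (flatmx0 v) mulmx0.
by exists u, v.
Qed.

End Ranks.

(** * Extensions of a subspace by another *)

Section Extension.
Variables (F : fieldType) (a b : nat).

(** Generators of the extension of the row space of K by that of L: the span of
L and of the graph of the linear map that sends the rows of K to those of f. *)
Definition ext_mx k l (K : 'M[F]_(k, a)) (L : 'M[F]_(l, b)) (f : 'M[F]_(k, b)) :
  'M[F]_(k + l, a + b) := block_mx K f 0 L.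

Lemma ext_mx_free k l (K : 'M_(k, a)) (L : 'M_(l, b)) f :
  row_free K -> row_free L -> row_free (ext_mx K L f).
Proof.
move=> freeK freeL; rewrite -kermx_eq0; apply/rowV0P => v /sub_kermxP.
rewrite -[v]hsubmxK mul_row_block mulmx0 addr0 -row_mx0 => /eq_row_mx [v1K0].
have v1_0 : lsubmx v = 0 by apply: (row_free_inj freeK); rewrite v1K0 mul0mx.
rewrite v1_0 mul0mx add0r => v2L0.
have -> : rsubmx v = 0 by apply: (row_free_inj freeL); rewrite v2L0 mul0mx.
by rewrite row_mx0.
Qed.

Let pr1 : 'M[F]_(a + b, a) := col_mx 1%:M 0.

Lemma mul_pr1 m (A : 'M_(m, a + b)) : A *m pr1 = lsubmx A.
Proof. by rewrite -[A]hsubmxK mul_row_col mulmx1 mulmx0 addr0 row_mxKl. Qed.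

(** The first projection maps the intersection with kernel L :&: L'. *)
Lemma rank_cap_ext_split k l k' l' (K : 'M_(k, a)) (L : 'M_(l, b)) f
    (K' : 'M_(k', a)) (L' : 'M_(l', b)) f' :
    row_free K -> row_free K' ->
  (\rank (ext_mx K L f :&: ext_mx K' L' f')%MS <=
     \rank (lsubmx (ext_mx K L f :&: ext_mx K' L' f')%MS) +
     \rank (L :&: L')%MS)%N.
Proof.
move=> freeK freeK'.
(* As K0 is free, a combination of the rows of ext_mx K0 L0 f0 that is zero on
   the first block involves only the rows of L0. *)
have vert m j (K0 : 'M_(m, a)) (L0 : 'M_(j, b)) f0 (v : 'rV_b) :
    row_free K0 -> (row_mx 0 v <= ext_mx K0 L0 f0)%MS -> (v <= L0)%MS.
  move=> freeK0 /submxP [x]; rewrite -[x]hsubmxK mul_row_block mulmx0 addr0.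
  move=> /eq_row_mx [x1K0 ->]; apply/submxP; exists (rsubmx x).
  have -> : lsubmx x = 0 by apply: (row_free_inj freeK0); rewrite -x1K0 mul0mx.
  by rewrite mul0mx add0r.
rewrite -(mxrank_mul_ker _ pr1) mul_pr1 leq_add2l.
rewrite -(rank_row_0mx a (L :&: L')%MS) mxrankS //.
apply/rV_subP => v; rewrite !sub_capmx -andbA => /and3P [vN vN' /sub_kermxP].
rewrite mul_pr1 => v1_0; move: vN vN'; rewrite -[v]hsubmxK v1_0.
move=> /(vert _ _ _ _ _ _ freeK) vL /(vert _ _ _ _ _ _ freeK') vL'.
have: (rsubmx v <= L :&: L')%MS by rewrite sub_capmx vL.
by case/submxP=> x ->; apply/submxP; exists x; rewrite mul_mx_row mulmx0.
Qed.

Lemma rank_cap_ext k l k' l' (K : 'M_(k, a)) (L : 'M_(l, b)) f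
    (K' : 'M_(k', a)) (L' : 'M_(l', b)) f' :
    row_free K -> row_free K' ->
  (\rank (ext_mx K L f :&: ext_mx K' L' f')%MS <=
     \rank (K :&: K')%MS + \rank (L :&: L')%MS)%N.
Proof.
move=> freeK freeK'.
apply: leq_trans (rank_cap_ext_split _ _ _ _ freeK freeK') _.
rewrite leq_add2r mxrankS // -mul_pr1.
have sub m j (K0 : 'M_(m, a)) (L0 : 'M_(j, b)) f0 :
    (ext_mx K0 L0 f0 *m pr1 <= K0)%MS.
  rewrite mul_pr1; apply/submxP; exists (col_mx 1%:M 0).
  by rewrite mul_col_mx mul1mx mul0mx /ext_mx block_mxEh row_mxKl.
by rewrite sub_capmx (submx_trans (submxMr _ (capmxSl _ _)))
  ?(submx_trans (submxMr _ (capmxSr _ _))).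
Qed.

(** By the hypothesis on C, the rows of C are independent modulo the row space
of L. The projection of the intersection consists of vectors x *m K with x in the
kernel of delta. *)
Lemma rank_cap_ext_same k l l' c (K : 'M_(k, a)) (L : 'M_(l, b))
    (L' : 'M_(l', b)) (C : 'M_(c, b)) (delta : 'M_(k, c)) f g :
    row_free K -> row_free (col_mx C L) -> (L' <= L)%MS ->
    (g <= L)%MS ->
  (\rank (ext_mx K L f :&: ext_mx K L' (f + delta *m C + g))%MS
     <= (k - \rank delta) + \rank L')%N.
Proof.
move=> freeK freeCL sL'L sgL.
apply: leq_trans (rank_cap_ext_split _ _ _ _ freeK freeK) _.
apply: leq_add; last by rewrite mxrankS ?capmxSr.
rewrite -mxrank_ker -(mxrankMfree _ freeK) mxrankS // -mul_pr1.
apply/rV_subP => v /submxP [x ->]; rewrite mulmxA mul_pr1.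
set w := x *m _.
have: (w <= ext_mx K L f :&: ext_mx K L' (f + delta *m C + g))%MS.
  exact: submxMl.
rewrite sub_capmx => /andP [/submxP [y wE] /submxP [z]]; rewrite {}wE {x w}.
rewrite -[y]hsubmxK -[z]hsubmxK !mul_row_block row_mxKl !mulmx0 !addr0.
set y1 := lsubmx y; set y2 := rsubmx y; set z1 := lsubmx z; set z2 := rsubmx z.
case/eq_row_mx=> /(row_free_inj freeK) <- {z1}; rewrite !mulmxDr -!addrA.
move=> /addrI /esym /(canRL (addrK _)) y1E.
rewrite submxMr //; apply/sub_kermxP.
have: (y1 *m delta *m C <= L)%MS.
  rewrite -mulmxA y1E addmx_sub ?submxMl // eqmx_opp addmx_sub //.
    exact: submx_trans (submxMl _ _) sgL.
  exact: submx_trans (submxMl _ _) sL'L.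
case/submxP=> u uE.
have: row_mx (y1 *m delta) (- u) *m col_mx C L = 0.
  by rewrite mul_row_col mulNmx -uE subrr.
rewrite -(mul0mx _ (col_mx C L)) -row_mx0 => /(row_free_inj freeCL).
by case/eq_row_mx.
Qed.

Lemma rank_cap_ext_mul k l c (K : 'M_(k, a)) (L : 'M_(l, b)) (C : 'M_(c, b))
    (d d' : 'M_(k, c)) :
    row_free K -> row_free (col_mx C L) ->
  (\rank (ext_mx K L (d *m C) :&: ext_mx K L (d' *m C))%MS
     <= (k - \rank (d' - d)%R) + l)%N.
Proof.
move=> freeK freeCL.
have -> : d' *m C = d *m C + (d' - d) *m C + 0.
  by rewrite addr0 -mulmxDl [d + _]addrC subrK.
apply: leq_trans (rank_cap_ext_same _ _ freeK freeCL _ _) _;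
  rewrite ?submx_refl ?sub0mx //.
by rewrite leq_add2l rank_leq_row.
Qed.

(** Extensions by 0 are graphs, and two graphs meet above the kernel of the
difference of the two maps. *)
Lemma rank_cap_graph k (K : 'M[F]_(k, a)) (A B : 'M_(k, b)) :
    row_free K ->
  (\rank (ext_mx K (0 : 'M_(0, b)) A :&: ext_mx K (0 : 'M_(0, b)) B)%MS
     <= k - \rank (B - A)%R)%N.
Proof.
move=> freeK; rewrite -(addn0 (k - _)%N) -{1}[A]mulmx1 -{1}[B]mulmx1.
apply: rank_cap_ext_mul => //.
by rewrite /row_free -addsmxE addsmx0 mxrank1 addn0.
Qed.

End Extension.

(** * Rank-metric codes *)

Lemma large_fibre (T T' : finType) (f : T -> T') q :
    (q * #|T'| <= #|T|)%N -> (0 < #|T|)%N ->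
  exists y, (q <= #|[set x | f x == y]|)%N.
Proof.
move=> leq_qT T_gt0; apply/existsP/contraT.
rewrite negb_exists => /forallP small.
have [x0 _] := card_gt0P T_gt0; pose y0 := f x0.
move: leq_qT; rewrite leqNgt => /negP []; rewrite -sum1_card.
rewrite (partition_big f xpredT) //= mulnC -sum_nat_const.
rewrite (bigD1 y0) //= [X in (_ < X)%N](bigD1 y0) //= -addSn leq_add //.
  by rewrite sum1dep_card ltnNge.
by apply: leq_sum => y _; rewrite sum1dep_card ltnW // ltnNge.
Qed.

(** The bilinear map given by the multiplication of a field L of order p^n, with
respect to a basis of L, has no zero divisors. Extend it linearly to a map Phi
from matrices to L: Phi vanishes on no matrix of rank 1, so that any fibre of
Phi has the required property, and some fibre has the average size. *)
Lemma mrd_code p n : prime p -> (0 < n)%N ->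
  exists D : {set 'M['F_p]_n}, (p ^ (n * n.-1) <= #|D|)%N /\
    {in D &, forall A B, A != B -> (1 < \rank (A - B)%R)%N}.
Proof.
move=> p_pr n_gt0; have [L pcharL cardL] := pPrimePowerField p_pr n_gt0.
pose R := pPrimeCharType pcharL.
have dimR : \dim {:R} = n by rewrite pprimeChar_dimf cardL pfactorK.
pose e := tcast dimR (vbasis {:R}).
have /freeP free_e : free e by rewrite val_tcast (basis_free (vbasisP _)).
pose ev (u : 'rV['F_p]_n) : R := \sum_i u 0 i *: e`_i.
have ev_eq0 u : ev u = 0 -> u = 0.
  by move/free_e => u0; apply/rowP => i; rewrite mxE u0.
pose Phi (A : 'M['F_p]_n) : R := \sum_i \sum_j A i j *: (e`_i * e`_j).
have PhiB A B : Phi (A - B) = Phi A - Phi B.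
  rewrite /Phi -sumrB; apply: eq_bigr => i _; rewrite -sumrB.
  by apply: eq_bigr => j _; rewrite !mxE scalerBl.
have Phi_mul u v : Phi (u *m v) = ev u^T * ev v.
  rewrite /ev mulr_suml; apply: eq_bigr => i _; rewrite mulr_sumr.
  apply: eq_bigr => j _.
  by rewrite mxE big_ord1 mxE -scalerAl -scalerAr scalerA.
have [||y ley] := @large_fibre _ _ Phi (p ^ (n * n.-1)).
- rewrite card_mx card_Fp // cardL -expnD leq_exp2l ?prime_gt1 //.
  by rewrite addnC -mulnS prednK.
- by rewrite card_mx card_Fp // expn_gt0 prime_gt0.
exists [set A | Phi A == y]; split=> [|A B]; first exact: ley.
rewrite !inE => /eqP PA /eqP PB.
apply: contraNltn => /rank_le1_mul [u [v AB]].
have /eqP: Phi (A - B) = 0 by rewrite PhiB PA PB subrr.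
rewrite -(subr_eq0 A B) AB Phi_mul mulf_eq0 => /orP [] /eqP /ev_eq0.
  by move/(congr1 trmx); rewrite trmxK trmx0 => ->; rewrite mul0mx.
by move=> ->; rewrite mulmx0.
Qed.

(** * Lines of F_2^4 *)

(** A partition of the 35 lines of F_2^4 into 7 spreads of 5 disjoint lines. A
line is given by two of its points, and a vector by the number whose binary
digits are its coordinates. *)
Definition parallelism : seq (seq (nat * nat)) :=
  [:: [:: (1, 2); (4, 8); (5, 10); (6, 11); (7, 9)];
      [:: (1, 4); (2, 8); (3, 13); (6, 9); (7, 11)];
      [:: (1, 6); (2, 9); (3, 12); (4, 10); (5, 8)];
      [:: (1, 8); (2, 12); (3, 5); (4, 11); (7, 10)];
      [:: (1, 10); (2, 13); (3, 4); (5, 9); (6, 8)];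
      [:: (1, 12); (2, 4); (3, 9); (5, 11); (7, 8)];
      [:: (1, 14); (2, 5); (3, 8); (4, 9); (6, 10)]]%N.

(** The two generators of the line of index i in the spread of index c. *)
Definition gens c i : nat * nat := nth (0, 0)%N (nth [::] parallelism c) i.

(** The vector of the first four binary digits of x, least significant first. *)
Definition bits (x : nat) : 'rV['F_2]_4 := \row_j (Nat.testbit x j)%:R.

Definition line (c i : nat) : 'M['F_2]_(2, 4) :=
  \matrix_(k < 2) bits (if k == 0 then (gens c i).1 else (gens c i).2).

(** The number of the combination, with coefficients a and b, of the two
generators of a line. *)
Definition point c i (a b : bool) : nat :=
  Nat.lxor (if a then (gens c i).1 else 0%N) (if b then (gens c i).2 else 0%N).

(** Equality of the first four binary digits. *)
Definition same4 x y :=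
  all (fun j => Nat.testbit x j == Nat.testbit y j) (iota 0 4).

Lemma row2P (R : nzRingType) (v : 'rV[R]_2) :
  v 0 ord0 = 0 -> v 0 (lift ord0 ord0) = 0 -> v = 0.
Proof.
move=> v0 v1; apply/rowP => j; rewrite mxE; case: j => [[|[|//]] ltj].
  by rewrite -[RHS]v0; congr (v _ _); apply: val_inj.
by rewrite -[RHS]v1; congr (v _ _); apply: val_inj.
Qed.

Lemma F2_boolE (x : 'F_2) : x = (x != 0)%:R.
Proof. by case: x => [[|[|//]] ltx]; apply: val_inj. Qed.

Lemma F2_ind (P : 'F_2 -> Prop) : P 0 -> P 1 -> forall x, P x.
Proof. by move=> P0 P1 x; rewrite (F2_boolE x); case: (x != 0). Qed.

Lemma F2_addb (a b : bool) : (a (+) b)%:R = a%:R + b%:R :> 'F_2.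
Proof. by case: a b => [] [] //; apply: val_inj. Qed.

Lemma bits_lxor x y : bits (Nat.lxor x y) = bits x + bits y.
Proof.
apply/rowP => j; rewrite !mxE Nat.lxor_spec -F2_addb.
by case: (Nat.testbit x j) (Nat.testbit y j) => [] [].
Qed.

Lemma bits_inj4 x y : bits x = bits y -> same4 x y.
Proof.
move=> eq_xy; apply/allP => j; rewrite mem_iota => /= ltj.
have /(congr1 val) := congr1 (fun v : 'rV_4 => v 0 (Ordinal ltj)) eq_xy.
by rewrite /= !mxE /=; case: (Nat.testbit x j) (Nat.testbit y j) => [] [].
Qed.

Lemma bits0 : bits 0 = 0.
Proof. by apply/rowP => j; rewrite !mxE Nat.bits_0. Qed.

Lemma bits_eq0 x : same4 x 0 -> bits x = 0.
Proof.
move=> /allP x0; rewrite -bits0; apply/rowP => j; rewrite !mxE.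
by rewrite (eqP (x0 j _)) // mem_iota ltn_ord.
Qed.

Lemma mul_line c i (x : 'rV_2) :
  x *m line c i = bits (point c i (x 0 0 != 0) (x 0 1 != 0)).
Proof.
rewrite bits_lxor mulmx_sum_row !big_ord_recl big_ord0 addr0 !rowK /=.
have -> : lift ord0 ord0 = 1 :> 'I_2 by apply: val_inj.
rewrite [x 0 ord0]F2_boolE [x 0 1 in LHS]F2_boolE.
by case: (x 0 0 != 0) (x 0 1 != 0) => [] []; rewrite ?scale1r ?scale0r ?bits0.
Qed.

Lemma mem_line c i (v : 'rV_4) :
  (v <= line c i)%MS -> exists a b, v = bits (point c i a b).
Proof. by case/submxP=> x ->; rewrite mul_line; do 2!eexists. Qed.

(** Quantification over all booleans and over all indices of lines, in a form
that computes. *)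
Definition all_bool (P : pred bool) := P true && P false.

Lemma all_boolP (P : pred bool) : reflect (forall b, P b) (all_bool P).
Proof. by apply: (iffP andP) => [[Pt Pf] [] | PT] //; split. Qed.

Definition all_line (P : nat -> nat -> bool) :=
  all (fun c => all (P c) (iota 0 5)) (iota 0 7).

Lemma all_lineP P : all_line P -> forall c i, (c < 7)%N -> (i < 5)%N -> P c i.
Proof.
move=> /allP allP c i ltc lti.
by move/(_ c): allP; rewrite mem_iota => /(_ ltc)/allP; apply; rewrite mem_iota.
Qed.

Lemma line_free c i : (c < 7)%N -> (i < 5)%N -> row_free (line c i).
Proof.
have: all_line (fun c i => all_bool (fun a => all_bool (fun b =>
  same4 (point c i a b) 0 ==> ~~ a && ~~ b))) by vm_compute.
move/all_lineP => chk ltc lti.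
rewrite -kermx_eq0; apply/rowV0P => v /sub_kermxP.
rewrite mul_line -bits0 => /bits_inj4; move: (chk c i ltc lti).
move/all_boolP/(_ (v 0 0 != 0))/all_boolP/(_ (v 0 1 != 0))/implyP => H /H.
rewrite !negbK => /andP [/eqP v0 /eqP v1]; apply: row2P; first exact: v0.
by rewrite -[RHS]v1; congr (v _ _); apply: val_inj.
Qed.

Lemma line_cap_parallel c i j :
    (c < 7)%N -> (i < 5)%N -> (j < 5)%N -> i != j ->
  (line c i :&: line c j)%MS = 0.
Proof.
have: all_line (fun c i => all (fun j => (i != j) ==>
    all_bool (fun a => all_bool (fun b => all_bool (fun a' => all_bool (fun b' =>
      same4 (point c i a b) (point c j a' b') ==> same4 (point c i a b) 0)))))
    (iota 0 5)).
  by vm_compute.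
move/all_lineP => chk ltc lti ltj neq_ij.
apply/eqP/rowV0P => v; rewrite sub_capmx => /andP [].
move=> /mem_line [a [b ->]] /mem_line [a' [b' /bits_inj4 E]]; apply: bits_eq0.
move/allP/(_ j): (chk c i ltc lti); rewrite mem_iota ltj neq_ij => /(_ isT).
move/all_boolP/(_ a)/all_boolP/(_ b)/all_boolP/(_ a')/all_boolP/(_ b').
by rewrite E.
Qed.

(** Lines of different spreads are distinct: a common subspace of dimension 2
would put the generators of the first line among the points of the second. *)
Lemma line_cap_skew c c' i j :
    (c < 7)%N -> (c' < 7)%N -> (i < 5)%N -> (j < 5)%N -> c != c' ->
  (\rank (line c i :&: line c' j)%MS <= 1)%N.
Proof.
have: all_line (fun c i => all_line (fun c' j => (c != c') ==>
    all_bool (fun a => all_bool (fun b => all_bool (fun a' => all_bool (fun b' =>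
      ~~ (same4 (gens c i).1 (point c' j a b) &&
          same4 (gens c i).2 (point c' j a' b')))))))).
  by vm_compute.
move/all_lineP => chk ltc ltc' lti ltj neq_cc'.
rewrite leqNgt; apply/negP => rank_gt1.
have: (line c i <= line c i :&: line c' j)%MS.
  rewrite -(geq_leqif (mxrank_leqif_sup (capmxSl _ _))).
  exact: leq_trans (rank_leq_row _) rank_gt1.
move/submx_trans/(_ (capmxSr _ _)) => sub.
have row_in k := submx_trans (row_sub k (line c i)) sub.
have [a [b Eu]] := mem_line (row_in 0).
have [a' [b' Ev]] := mem_line (row_in 1).
move: Eu Ev; rewrite !rowK /= => /bits_inj4 Eu /bits_inj4 Ev.
move/all_lineP/(_ c' j ltc' ltj)/implyP/(_ neq_cc'): (chk c i ltc lti).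
move/all_boolP/(_ a)/all_boolP/(_ b)/all_boolP/(_ a')/all_boolP/(_ b').
by rewrite Eu Ev.
Qed.

Lemma line_cap (c c' : 'I_7) (i j : 'I_5) : (c, i) != (c', j) ->
  (\rank (line c i :&: line c' j)%MS <= (c != c'))%N.
Proof.
rewrite xpair_eqE; have [<-|neq_cc' _] /= := eqVneq c c'.
  by move=> neq_ij; rewrite line_cap_parallel ?mxrank0 ?ltn_ord.
by rewrite line_cap_skew ?ltn_ord.
Qed.

(** Two lines of a spread are complements of each other. Below,
[line c (ordS i)] serves as the complement of [line c i]. *)
Lemma spread_free c (i : 'I_5) :
  (c < 7)%N -> row_free (col_mx (line c (ordS i)) (line c i)).
Proof.
move=> ltc; apply: row_free_col_mx; rewrite ?line_free ?ltn_ord //.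
by apply: line_cap_parallel; rewrite ?ltn_ord //; case: i => [[|[|[|[|[|]]]]]].
Qed.

(** * Small matrices over F_2 *)

(** The Hankel matrix of the sequence a, b, a + b. These 4 matrices form a
field of order 4, and they are symmetric. *)
Definition hankel2 (s : 'F_2 * 'F_2) : 'M['F_2]_2 :=
  let: (a, b) := s in \matrix_(i, j) [:: a; b; a + b]`_(i + j).

(** The Hankel matrix of the first terms x_0, ..., x_3 of a binary sequence with
recurrence x_(k+3) = x_(k+2) + x_k, namely b + c, a, b, c. The characteristic
polynomial of the recurrence is irreducible, whence [hankel3_rank]. *)
Definition hankel3 (s : 'F_2 * 'F_2 * 'F_2) : 'M['F_2]_(2, 3) :=
  let: (a, b, c) := s in \matrix_(i, j) [:: b + c; a; b; c]`_(i + j).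

Lemma hankel2_rank s : s != 0 -> \rank (hankel2 s) = 2%N.
Proof.
case: s => a b s_neq0; apply/eqP; change (row_free (hankel2 (a, b))).
rewrite -kermx_eq0; apply/rowV0P => v /sub_kermxP /rowP vs0.
have /eqP := vs0 0; have /eqP := vs0 1.
rewrite !mxE !big_ord_recl !big_ord0 !mxE /= => {vs0} e1 e0.
suff /andP [/eqP v0 /eqP v1] : (v 0 ord0 == 0) && (v 0 (lift ord0 ord0) == 0).
  exact: row2P.
move: s_neq0 e1 e0; move: a b (v 0 ord0) (v 0 (lift ord0 ord0)).
by do 4 elim/F2_ind.
Qed.

Lemma hankel3_rank s : s != 0 -> \rank (hankel3 s) = 2%N.
Proof.
case: s => [[a b] c] s_neq0; apply/eqP; change (row_free (hankel3 (a, b, c))).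
rewrite -kermx_eq0; apply/rowV0P => v /sub_kermxP /rowP vs0.
have /eqP := vs0 (inord 2); have /eqP := vs0 (inord 1); have /eqP := vs0 0.
rewrite !mxE !big_ord_recl !big_ord0 !mxE !inordK //= => {vs0} e0 e1 e2.
suff /andP [/eqP v0 /eqP v1] : (v 0 ord0 == 0) && (v 0 (lift ord0 ord0) == 0).
  exact: row2P.
move: s_neq0 e0 e1 e2; move: a b c (v 0 ord0) (v 0 (lift ord0 ord0)).
by do 5 elim/F2_ind.
Qed.

Lemma hankel2B s t : hankel2 s - hankel2 t = hankel2 (s - t).
Proof.
case: s t => [a b] [a' b']; apply/matrixP => i j; rewrite !mxE.
by case: (i + j)%N => [|[|[|k]]] /=; rewrite ?nth_nil ?subr0 // opprD addrACA.
Qed.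

Lemma hankel3B s t : hankel3 s - hankel3 t = hankel3 (s - t).
Proof.
case: s t => [[a b] c] [[a' b'] c']; apply/matrixP => i j; rewrite !mxE.
by case: (i + j)%N => [|[|[|[|k]]]] /=; rewrite ?nth_nil ?subr0 // opprD addrACA.
Qed.

(** A translate of the space of the matrices [hankel3 s]. The last two columns
of [psi s] form a matrix that is not symmetric, hence not of the form
[hankel2 t]. *)
Definition psi s : 'M['F_2]_(2, 1 + 2) :=
  hankel3 s + delta_mx 0 (ord_max : 'I_3).

Lemma psiB s t : psi s - psi t = hankel3 (s - t).
Proof. by rewrite -hankel3B /psi opprD addrACA subrr addr0. Qed.

Lemma psi_hankel2 s t : rsubmx (psi s) != hankel2 t.
Proof.
case: s t => [[a b] c] [a' b']; apply/eqP => /matrixP E.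
have /eqP := E 0 1; have /eqP := E 1 0; rewrite !mxE /= => {E}.
by move: a b c a' b'; do 5 elim/F2_ind.
Qed.

(** The companion matrix of X^2 + X + 1. It has no eigenvector. *)
Definition companion2 : 'M['F_2]_2 := hankel2 (0, 1).

Lemma companion2_free (r : 'rV_2) :
  r != 0 -> row_free (col_mx (r *m companion2) r).
Proof.
move=> r_neq0; rewrite -kermx_eq0; apply/rowV0P => x /sub_kermxP.
rewrite -[x]hsubmxK mul_row_col.
rewrite (mx11_scalar (lsubmx x)) (mx11_scalar (rsubmx x)) !mul_scalar_mx.
move: (lsubmx x 0 0) (rsubmx x 0 0) => y z /rowP E.
have /eqP := E ord0; have /eqP := E (lift ord0 ord0).
rewrite !mxE !big_ord_recl !big_ord0 !mxE /= => {E} e1 e0.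
suff /andP [/eqP -> /eqP ->] : (y == 0) && (z == 0) by rewrite !raddf0 row_mx0.
have {r_neq0}: (r 0 ord0 != 0) || (r 0 (lift ord0 ord0) != 0).
  apply: contraNT r_neq0; rewrite negb_or !negbK => /andP [/eqP r0 /eqP r1].
  by apply/eqP/row2P.
move: e1 e0; move: y z (r 0 ord0) (r 0 (lift ord0 ord0)).
by do 4 elim/F2_ind.
Qed.

(** * Points of the second and third summands *)

(** The point with coordinates r on the line of index i of the first spread.
Every point of F_2^4 is of this form, for a unique i and a unique nonzero r. *)
Definition pt (i : 'I_5) (r : 'rV['F_2]_2) : 'rV_4 := r *m line 0 i.

(** A basis of a complement of [pt i r]: a second point of the line of index i,
and a complement of that line. *)
Definition pt_compl (i : 'I_5) (r : 'rV['F_2]_2) : 'M_(1 + 2, 4) :=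
  col_mx (r *m companion2 *m line 0 i) (line 0 (ordS i)).

Lemma pt_compl_free i r : r != 0 -> row_free (col_mx (pt_compl i r) (pt i r)).
Proof.
move=> r_neq0; rewrite -kermx_eq0; apply/rowV0P => x /sub_kermxP.
rewrite -[x]hsubmxK -[lsubmx x]hsubmxK /pt_compl /pt !mul_row_col.
set y := lsubmx (lsubmx x); set z := rsubmx (lsubmx x); set t := rsubmx x.
have -> : y *m (r *m companion2 *m line 0 i) + z *m line 0 (ordS i)
    + t *m (r *m line 0 i)
  = row_mx z (row_mx y t *m col_mx (r *m companion2) r)
      *m col_mx (line 0 (ordS i)) (line 0 i).
  by rewrite !mul_row_col mulmxDl -!mulmxA addrAC addrC.
move/eqP; rewrite (mulmx_free_eq0 _ (@spread_free 0 i isT)) row_mx_eq0.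
case/andP=> /eqP ->.
rewrite (mulmx_free_eq0 _ (companion2_free r_neq0)) row_mx_eq0.
case/andP=> /eqP -> /eqP ->.
by rewrite !row_mx0.
Qed.

Lemma pt_free i r : r != 0 -> row_free (pt i r).
Proof.
move=> r_neq0; rewrite -kermx_eq0; apply/rowV0P => x /sub_kermxP.
have -> : x *m pt i r = row_mx 0 x *m col_mx (pt_compl i r) (pt i r).
  by rewrite mul_row_col mul0mx add0r.
move/eqP; rewrite (mulmx_free_eq0 _ (pt_compl_free i r_neq0)) row_mx_eq0.
by case/andP=> _ /eqP.
Qed.

Lemma pt_sub i r : (pt i r <= line 0 i)%MS.
Proof. exact: submxMl. Qed.

Lemma pt_cap i r i' r' :
    r != 0 -> r' != 0 -> (i, r) != (i', r') ->
  (pt i r :&: pt i' r')%MS = 0.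
Proof.
move=> r0 r'0 neq; have [eq_i | neq_i] := eqVneq i i'; last first.
  apply/eqP; rewrite -submx0.
  rewrite -(line_cap_parallel (c := 0) isT (ltn_ord i) (ltn_ord i')) //.
  by rewrite capmxS ?pt_sub.
rewrite -{i'}eq_i xpair_eqE eqxx /= in neq *.
apply/eqP/rowV0P => v; rewrite sub_capmx.
case/andP=> /sub_rVP [a ->] /sub_rVP [b].
move: a b; elim/F2_ind; elim/F2_ind; rewrite ?scale0r ?scale1r //.
move/(row_free_inj (line_free (c := 0) isT (ltn_ord i))) => rr'.
by rewrite rr' eqxx in neq.
Qed.

(** * Planes and solids of F_2^8 *)

(** The indices of the planes: a point [pt i r], a line of the first spread and
a parameter of [psi]. *)
Definition plane_index : finType :=
  ('I_5 * {r : 'rV['F_2]_2 | r != 0} * 'I_5 * ('F_2 * 'F_2 * 'F_2))%type.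

Definition plane_pt (u : plane_index) : 'M['F_2]_(1, 4) :=
  let: (i, r, _, _) := u in pt i (val r).

Definition plane_pt_compl (u : plane_index) : 'M['F_2]_(3, 4) :=
  let: (i, r, _, _) := u in pt_compl i (val r).

(** The extension of a line by a point, both taken from the first spread. *)
Definition plane (u : plane_index) : 'M['F_2]_(3, 8) :=
  let: (i, r, j, s) := u in
  ext_mx (line 0 j) (pt i (val r)) (psi s *m pt_compl i (val r)).

Lemma plane_free u : row_free (plane u).
Proof.
case: u => [[[i r] j] s]; apply: (@ext_mx_free _ 4 4 2 1).
  exact: line_free.
exact: pt_free (valP r).
Qed.

Lemma plane_pt_compl_free u : row_free (col_mx (plane_pt_compl u) (plane_pt u)).
Proof. by case: u => [[[i r] j] s]; apply: pt_compl_free (valP r). Qed.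

Lemma plane_pt_free u : row_free (plane_pt u).
Proof. by case: u => [[[i r] j] s]; apply: pt_free (valP r). Qed.

(** The left-hand side bounds the dimension of the intersection of any two words
above the planes u and v. *)
Lemma plane_cap u v : u != v ->
  (\rank (plane u :&: plane v)%MS +
     \rank (plane_pt u :&: plane_pt v)%MS <= 2)%N.
Proof.
case: u v => [[[i r] j] s] [[[i' r'] j'] s'] neq; rewrite /plane /plane_pt.
have [eq_p | neq_p] := eqVneq (i, r) (i', r'); last first.
  have {}neq_p : (i, val r) != (i', val r') by rewrite xpair_eqE val_eqE.
  rewrite (pt_cap (valP r) (valP r') neq_p) mxrank0 addn0.
  apply: leq_trans (@rank_cap_ext _ 4 4 2 1 2 1 _ _ _ _ _ _ _ _) _;
    rewrite ?line_free //.
  rewrite (pt_cap (valP r) (valP r') neq_p) mxrank0 addn0.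
  exact: rank_capl.
case: eq_p neq => <- <- neq {i' r'}.
apply: (@leq_add _ _ 1 1); last exact: rank_capl.
have [eq_j | neq_j] := eqVneq j j'; last first.
  apply: leq_trans (@rank_cap_ext _ 4 4 2 1 2 1 _ _ _ _ _ _ _ _) _;
    rewrite ?line_free //.
  rewrite line_cap_parallel // mxrank0 add0n.
  exact: rank_capl.
rewrite -{}eq_j in neq *.
have neq_s : s' - s != 0.
  by rewrite subr_eq0; apply: contraNneq neq => ->.
apply: leq_trans (@rank_cap_ext_mul _ 4 4 2 1 3 _ _ _ _ _ _ _) _;
  rewrite ?line_free ?pt_compl_free ?(valP r) //.
by rewrite psiB hankel3_rank.
Qed.

Section Code.

Variables (D4 : {set 'M['F_2]_4}) (D3 : {set 'M['F_2]_3}).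
Hypothesis rank_D4 : {in D4 &, forall A B, A != B -> (1 < \rank (A - B)%R)%N}.
Hypothesis rank_D3 : {in D3 &, forall A B, A != B -> (1 < \rank (A - B)%R)%N}.

(** The indices of the solids: a matrix of D4, or the index c of a spread, two
lines of this spread and a parameter of [hankel2]. *)
Definition solid_index : finType :=
  ({A | A \in D4} + 'I_7 * 'I_5 * 'I_5 * ('F_2 * 'F_2))%type.

(** A graph, that is an extension by the span of a matrix without rows, or an
extension of a line by a line of the same spread. *)
Definition solid (k : solid_index) : 'M['F_2]_(4, 8) :=
  match k with
  | inl A => ext_mx 1%:M (0 : 'M_(0, 4)) (val A)
  | inr (c, j, i, s) =>
      ext_mx (line c j) (line c i) (hankel2 s *m line c (ordS i))
  end.

Lemma solid_free k : row_free (solid k).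
Proof.
case: k => [A | [[[c j] i] s]].
  by apply: (@ext_mx_free _ 4 4 4 0); rewrite ?row_free1 ?row_free0.
by apply: (@ext_mx_free _ 4 4 2 2); rewrite ?line_free ?ltn_ord.
Qed.

Lemma solid_cap k l : k != l -> (\rank (solid k :&: solid l)%MS <= 2)%N.
Proof.
have graph_cap A c j i s :
    (\rank (solid (inl A) :&: solid (inr (c, j, i, s)))%MS <= 2)%N.
  apply: leq_trans (@rank_cap_ext _ 4 4 4 0 2 2 _ _ _ _ _ _ _ _) _;
    rewrite ?row_free1 ?line_free ?ltn_ord //.
  apply: (@leq_add _ _ 2 0).
    exact: rank_capr.
  exact: rank_capl.
case: k l => [A | [[[c j] i] s]] [B | [[[c' j'] i'] s']] neq; last 1 first.
- have [eq_j | neq_j] := eqVneq (c, j) (c', j'); last first.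
    apply: leq_trans (@rank_cap_ext _ 4 4 2 2 2 2 _ _ _ _ _ _ _ _) _;
    rewrite ?line_free ?ltn_ord //.
    have [eq_c | neq_c] := eqVneq c c'.
      apply: (@leq_add _ _ 0 2); last exact: rank_capl.
      by rewrite (leq_trans (line_cap neq_j)) // eq_c eqxx.
    apply: (@leq_add _ _ 1 1); apply: leq_trans (line_cap _) (leq_b1 _) => //.
    by rewrite xpair_eqE negb_and neq_c.
  case: eq_j neq => <- <- neq {c' j'}.
  have [eq_i | neq_i] := eqVneq i i'; last first.
    apply: leq_trans (@rank_cap_ext _ 4 4 2 2 2 2 _ _ _ _ _ _ _ _) _;
    rewrite ?line_free ?ltn_ord //.
    rewrite [X in (_ + \rank X)%N]line_cap_parallel ?ltn_ord // mxrank0 addn0.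
    exact: rank_capl.
  rewrite -{}eq_i in neq *.
  have neq_s : s' - s != 0 by rewrite subr_eq0; apply: contraNneq neq => ->.
  apply: leq_trans (@rank_cap_ext_mul _ 4 4 2 2 2 _ _ _ _ _ _ _) _;
    rewrite ?line_free ?spread_free ?ltn_ord //.
  by rewrite hankel2B hankel2_rank.
- apply: leq_trans (@rank_cap_graph _ 4 4 4 _ _ _ _) _; first exact: row_free1.
  have neqBA : val B != val A.
    by rewrite eq_sym; apply: contraNneq neq => /val_inj ->.
  exact: leq_sub2l (rank_D4 (valP B) (valP A) neqBA).
- exact: graph_cap.
by rewrite capmxC graph_cap.
Qed.

Lemma plane_solid_cap u k : (\rank (plane u :&: solid k)%MS <= 2)%N.
Proof.
case: u k => [[[i r] j] s] [A | [[[c j'] i'] t]].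
  apply: leq_trans (@rank_cap_ext _ 4 4 2 1 4 0 _ _ _ _ _ _ _ _) _;
    rewrite ?row_free1 ?line_free ?ltn_ord //.
  apply: (@leq_add _ _ 2 0).
    exact: rank_capl.
  exact: rank_capr.
have [eq_j | neq_j] := eqVneq (ord0, j) (c, j'); last first.
  apply: leq_trans (@rank_cap_ext _ 4 4 2 1 2 2 _ _ _ _ _ _ _ _) _;
    rewrite ?line_free ?ltn_ord //.
  apply: (@leq_add _ _ 1 1); first exact: leq_trans (line_cap neq_j) (leq_b1 _).
  exact: rank_capl.
case: eq_j => <- <- {c j'}.
have [<- | neq_i] := eqVneq i i'; last first.
  apply: leq_trans (@rank_cap_ext _ 4 4 2 1 2 2 _ _ _ _ _ _ _ _) _;
    rewrite ?line_free ?ltn_ord //.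
  rewrite [X in (_ + X)%N](_ : _ = 0%N) ?addn0.
    exact: rank_capl.
  apply/eqP; rewrite mxrank_eq0 -submx0.
  rewrite -(line_cap_parallel (c := 0) isT (ltn_ord i) (ltn_ord i') neq_i).
  by rewrite capmxS ?pt_sub.
rewrite capmxC /solid /plane.
(* Modulo line i, only the last two columns of psi s matter. *)
have psiE : psi s *m pt_compl i (val r) = hankel2 t *m line 0 (ordS i)
    + (rsubmx (psi s) - hankel2 t) *m line 0 (ordS i)
    + lsubmx (psi s) *m (val r *m companion2 *m line 0 i).
  rewrite -mulmxDl [hankel2 t + _]addrC subrK.
  by rewrite -{1}[psi s]hsubmxK mul_row_col addrC.
rewrite [X in ext_mx _ (pt _ _) X]psiE.
apply: leq_trans (@rank_cap_ext_same _ 4 4 2 2 1 2 _ _ _ _ _ _ _ _ _ _ _) _;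
  rewrite ?line_free ?spread_free ?pt_sub ?mulmxA ?submxMl //.
apply: (@leq_add _ _ 1 1); last exact: rank_leq_row.
by rewrite leq_subLR addn1 ltnS lt0n mxrank_eq0 subr_eq0 psi_hankel2.
Qed.

(** * The code *)

(** The indices of the words: a solid with a matrix of D4, or a plane with a
matrix of D3. *)
Definition word_index : finType :=
  (solid_index * {A | A \in D4} + plane_index * {A | A \in D3})%type.

Definition word (w : word_index) : 'M['F_2]_(4, 12) :=
  match w with
  | inl (k, A) => ext_mx (solid k) (0 : 'M_(0, 4)) (val A)
  | inr (u, B) => ext_mx (plane u) (plane_pt u) (val B *m plane_pt_compl u)
  end.

Lemma word_free w : row_free (word w).
Proof.
case: w => [[k A] | [u B]].
  by apply: (@ext_mx_free _ 8 4 4 0); rewrite ?solid_free ?row_free0.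
by apply: (@ext_mx_free _ 8 4 3 1); rewrite ?plane_free ?plane_pt_free.
Qed.

Lemma word_cap w x : w != x -> (\rank (word w :&: word x)%MS <= 2)%N.
Proof.
have mixed k A u B :
    (\rank (word (inr (u, B)) :&: word (inl (k, A)))%MS <= 2)%N.
  apply: leq_trans (@rank_cap_ext _ 8 4 3 1 4 0 _ _ _ _ _ _
      (plane_free u) (solid_free k)) _.
  apply: (@leq_add _ _ 2 0); first exact: plane_solid_cap.
  exact: rank_capr.
case: w x => [[k A] | [u B]] [[l A'] | [v B']] neq.
- have [eq_k | neq_k] := eqVneq k l; last first.
    apply: leq_trans (@rank_cap_ext _ 8 4 4 0 4 0 _ _ _ _ _ _
      (solid_free k) (solid_free l)) _.
    apply: (@leq_add _ _ 2 0); first exact: solid_cap.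
    exact: rank_capr.
  rewrite -{}eq_k in neq *.
  apply: leq_trans (@rank_cap_graph _ 8 4 4 _ _ _ (solid_free k)) _.
  have neqA : val A' != val A.
    by rewrite eq_sym; apply: contraNneq neq => /val_inj ->.
  exact: leq_sub2l (rank_D4 (valP A') (valP A) neqA).
- by rewrite capmxC mixed.
- exact: mixed.
have [eq_u | neq_u] := eqVneq u v; last first.
  apply: leq_trans (@rank_cap_ext _ 8 4 3 1 3 1 _ _ _ _ _ _
      (plane_free u) (plane_free v)) _.
  exact: plane_cap.
rewrite -{}eq_u in neq *.
have neqB : val B' != val B.
  by rewrite eq_sym; apply: contraNneq neq => /val_inj ->.
apply: leq_trans (@rank_cap_ext_mul _ 8 4 3 1 3 _ _ _ _ _ _ _) _;
  rewrite ?plane_free ?plane_pt_compl_free //.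
apply: (@leq_add _ _ 1 1) => //.
exact: leq_sub2l (rank_D3 (valP B') (valP B) neqB).
Qed.

Lemma card_word_index : #|word_index| = ((#|D4| + 700) * #|D4| + 600 * #|D3|)%N.
Proof.
have card_r : #|{: {r : 'rV['F_2]_2 | r != 0}}| = 3%N.
  by rewrite card_sig cardC1 card_mx card_Fp.
rewrite !(card_sum, card_prod, card_ord) card_r !card_sig.
by rewrite !(@eq_card _ (fun x => x \in _) _ (fun x => erefl)).
Qed.

End Code.

Local Close Scope ring_scope.

Theorem mainTheorem5 : 19676797 <= max_code_size 'F_2 12 4 4.
Proof.
have [D4 [card_D4 rank_D4]] := @mrd_code 2 4 isT isT.
have [D3 [card_D3 rank_D3]] := @mrd_code 2 3 isT isT.
have := @leq_max_code_size _ 12 4 2 _ (@word D4 D3) isT (@word_free D4 D3)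
  (word_cap rank_D4 rank_D3).
apply: leq_trans; rewrite card_word_index.
have {}card_D4 : 4096 <= #|D4| by exact: leq_trans card_D4.
have {}card_D3 : 64 <= #|D3| by exact: leq_trans card_D3.
have: (4096 + 700) * 4096 + 600 * 64 <= (#|D4| + 700) * #|D4| + 600 * #|D3|.
  by rewrite leq_add ?leq_mul ?leq_add.
(* The literal on the left is a decimal numeral, too large for unary notation:
   its Horner form is a term on which linear arithmetic works in binary. *)
apply: leq_trans; rewrite /Nat.of_num_uint /Nat.of_uint; cbn [Nat.of_uint_acc].
by rewrite !Nat.tail_mul_spec; lia.
Qed.
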